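(* For every real $t>0$ and every $\sigma\in(\frac12,2)$, \[ \frac{1}{2\pi i}\int_{-\infty-i\sigma}^{+\infty-i\sigma}\Bigl(\frac{t}{2\pi}\Bigr)^{\frac{ix}{2}}\zeta\bigl(\tfrac12+i(t+x)\bigr)\,\frac{\pi}{2\sinh\frac{\pi x}{2}}\,dx=\sum_{n=1}^\infty \frac{1}{n^{\frac12+it}}\,\frac{t}{2\pi n^2+t}. \] In particular $G(t)=\sum_{n\ge1} n^{-\frac12-it}\,\frac{t}{2\pi n^2+t}$.
   Context: $\zeta$ is the Riemann zeta function; $(t/2\pi)^{ix/2}=\exp(\frac{ix}{2}\log\frac{t}{2\pi})$. $G(t)$ denotes the integral on the left-hand side (integration along the horizontal line $\Im x=-\sigma$). *)

(* Defs.v *)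
From Stdlib Require Import Reals.
From Coquelicot Require Import Coquelicot.
Open Scope R_scope.

Definition cexp (z : C) : C :=
  (exp (Re z) * cos (Im z), exp (Re z) * sin (Im z)).

Definition rcpow (a : R) (z : C) : C := cexp (z * RtoC (ln a)).

Definition csinh (z : C) : C := ((cexp z - cexp (- z)) / 2)%C.

Definition zeta_term (s : C) (n : nat) : C := rcpow (INR (S n)) (- s)%C.

(* Riemann zeta function on the half-plane Re s > 1, given there by its
   (absolutely convergent) Dirichlet series sum_{n>=1} n^{-s}.
   Only used in the statement at points with Re s = 1/2 + sigma > 1. *)
Definition zeta (s : C) : C :=
  (Series (fun n => Re (zeta_term s n)), Series (fun n => Im (zeta_term s n))).

(* integrand of G(t) along the line Im x = -sigma, parametrized by x = u - i sigma *)
Definition G_integrand (t sigma u : R) : C :=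
  let x : C := (u, - sigma) in
  (rcpow (t / (2 * PI)) (Ci * x / 2) *
   zeta (RtoC (1/2) + Ci * (RtoC t + x)) *
   (RtoC PI / (2 * csinh (RtoC PI * x / 2))))%C.

Definition G_rhs_term (t : R) (n : nat) : C :=
  (rcpow (INR (S n)) (- (RtoC (1/2) + Ci * RtoC t)) *
   RtoC (t / (2 * PI * INR (S n) ^ 2 + t)))%C.

(* Main.v *)
(** On the line of integration [x = u - i sigma] the zeta factor is an absolutely
    convergent Dirichlet series and the integrand is bounded by a multiple of
    [1 / cosh (PI u / 2)], so sum and integral may be exchanged, and the term of index
    [n] leads to the integral of [exp (i l z) / sinh z] along [z = p - i q], where
    [exp (l PI) = t / (2 PI n^2)] and [0 < q < PI].

    The real part of this function is odd in [p].  The integral [J] of its imaginary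
    part over [0 < p] does not depend on [q], by the Cauchy-Riemann equations and decay at
    infinity.  Comparing the heights [q] and [PI - q], the combination
    [exp (- l q) J + exp (- l (PI - q)) J] is twice the integral of [cos (l p)] against the
    kernel [cosh p sin q / (sinh p ^ 2 + sin q ^ 2)], which has primitive
    [atan (sinh p / sin q)] and concentrates at [p = 0] as [q] tends to [0].  Hence
    [J (1 + exp (- l PI)) = PI]. *)
Require Import Defs.
From Stdlib Require Import Reals Lra Lia Psatz.
From Coquelicot Require Import Coquelicot.
Open Scope R_scope.

(** * Hyperbolic and trigonometric preliminaries *)

Lemma cosh_sqr p : cosh p * cosh p = 1 + sinh p * sinh p.
Proof.
  unfold cosh, sinh.
  pose proof (exp_plus p (-p)) as H. rewrite Rplus_opp_r, exp_0 in H. nra.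
Qed.

Lemma sin_sqr q : sin q * sin q = 1 - cos q * cos q.
Proof. pose proof (sin2_cos2 q) as H. unfold Rsqr in H. lra. Qed.

Lemma cosh_pos p : 0 < cosh p.
Proof. unfold cosh. pose proof (exp_pos p). pose proof (exp_pos (-p)). lra. Qed.

Lemma sinh_opp p : sinh (- p) = - sinh p.
Proof. unfold sinh. rewrite Ropp_involutive. field. Qed.

Lemma cosh_opp p : cosh (- p) = cosh p.
Proof. unfold cosh. rewrite Ropp_involutive. field. Qed.

Lemma is_derive_sinh x : is_derive sinh x (cosh x).
Proof. apply is_derive_Reals, derivable_pt_lim_sinh. Qed.

Lemma is_derive_cosh x : is_derive cosh x (sinh x).
Proof. apply is_derive_Reals, derivable_pt_lim_cosh. Qed.

Lemma sinh_ge p : 0 <= p -> p <= sinh p.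
Proof.
  intros Hp. destruct (Req_dec p 0) as [->|Hne]; [rewrite sinh_0; lra|].
  destruct (MVT_gen sinh 0 p cosh) as [c [Hc Heq]].
  - intros; apply is_derive_sinh.
  - intros. apply derivable_continuous_pt. exists (cosh x). apply derivable_pt_lim_sinh.
  - rewrite sinh_0 in Heq.
    assert (1 <= cosh c) by (pose proof (cosh_sqr c); pose proof (cosh_pos c); nra). nra.
Qed.

(** * The kernel and its Cauchy-Riemann equations *)

(* [kre] and [kim] are the real and imaginary part of [exp (i l z) / sinh z] at
   [z = p - i q]; there [kden] is the squared modulus of [sinh z]. *)
Definition kden (p q : R) : R := sinh p * sinh p + sin q * sin q.

Definition kre (l p q : R) : R :=
  exp (l * q) * (cos (l * p) * sinh p * cos q - sin (l * p) * cosh p * sin q) / kden p q.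

Definition kim (l p q : R) : R :=
  exp (l * q) * (cos (l * p) * cosh p * sin q + sin (l * p) * sinh p * cos q) / kden p q.

(** The common value of the [q]-derivative of [kim] and of minus the [p]-derivative of [kre]. It has
    the shape of the quotient rule in [q], where [2 * sin q * cos q] is the derivative of [kden]. *)
Definition kdiff (l p q : R) : R :=
  exp (l * q) *
  ((l * (cos (l * p) * cosh p * sin q + sin (l * p) * sinh p * cos q)
    + (cos (l * p) * cosh p * cos q - sin (l * p) * sinh p * sin q)) * kden p q
   - (cos (l * p) * cosh p * sin q + sin (l * p) * sinh p * cos q) * (2 * sin q * cos q))
  / (kden p q * kden p q).

Lemma kden_pos p q : 0 < q < PI -> 0 < kden p q.
Proof. intros Hq. unfold kden. pose proof (sin_gt_0 q). nra. Qed.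

Lemma is_derive_kim l p q : kden p q <> 0 -> is_derive (fun q => kim l p q) q (kdiff l p q).
Proof.
  unfold kim, kdiff, kden. intros H. auto_derive; [easy|]. field; easy.
Qed.

(* With [is_derive_kim], this is a Cauchy-Riemann equation. *)
Lemma is_derive_kre l p q : kden p q <> 0 -> is_derive (fun p => kre l p q) p (- kdiff l p q).
Proof.
  unfold kre, kdiff, kden. intros H. auto_derive.
  - repeat split; try easy; eexists; first [apply is_derive_sinh | apply is_derive_cosh].
  - replace (Derive (fun x => sinh x) p) with (cosh p)
      by (symmetry; apply is_derive_unique, is_derive_sinh).
    replace (Derive (fun x => cosh x) p) with (sinh p)
      by (symmetry; apply is_derive_unique, is_derive_cosh).
    pose proof (cosh_sqr p) as Hc. pose proof (sin_sqr q) as Hs.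
    field_simplify_eq; [|easy].
    ring [Hc Hs].
Qed.

Lemma continuous_sinh x : continuous sinh x.
Proof. apply (ex_derive_continuous (V := R_NormedModule)). eexists. apply is_derive_sinh. Qed.

Lemma continuous_cosh x : continuous cosh x.
Proof. apply (ex_derive_continuous (V := R_NormedModule)). eexists. apply is_derive_cosh. Qed.

(** Taken along arbitrary [f] and [g], so that it serves both for [p] alone and for the pair of [p]
    and [q]. *)
Lemma continuous_kden_inv (T : UniformSpace) (f g : T -> R) (x : T) :
  kden (f x) (g x) <> 0 -> continuous f x -> continuous g x ->
  continuous (fun y => / kden (f y) (g y)) x.
Proof.
  intros H Hf Hg.
  apply (continuous_comp (fun y => kden (f y) (g y)) Rinv).
  - unfold kden. apply (continuous_plus (fun y => sinh (f y) * sinh (f y)) (fun y => sin (g y) * sin (g y))).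
    + apply (continuous_mult (fun y => sinh (f y)) (fun y => sinh (f y)));
        apply (continuous_comp f sinh); try easy; apply continuous_sinh.
    + apply (continuous_mult (fun y => sin (g y)) (fun y => sin (g y)));
        apply (continuous_comp g sin); try easy; apply continuous_sin.
  - apply continuous_Rinv, H.
Qed.

Ltac solve_continuous := repeat first
  [ assumption
  | apply continuous_id | apply continuous_fst | apply continuous_snd | apply continuous_const
  | apply continuous_kden_inv
  | match goal with
    | |- continuous (fun x => @?f x + @?g x) _ => apply (continuous_plus f g)
    | |- continuous (fun x => @?f x - @?g x) _ => apply (continuous_minus f g)
    | |- continuous (fun x => @?f x * @?g x) _ => apply (continuous_mult f g)
    | |- continuous (fun x => sinh (@?f x)) _ => apply (continuous_comp f sinh); [|apply continuous_sinh]
    | |- continuous (fun x => cosh (@?f x)) _ => apply (continuous_comp f cosh); [|apply continuous_cosh]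
    | |- continuous (fun x => sin (@?f x)) _ => apply (continuous_comp f sin); [|apply continuous_sin]
    | |- continuous (fun x => cos (@?f x)) _ => apply (continuous_comp f cos); [|apply continuous_cos]
    | |- continuous (fun x => exp (@?f x)) _ => apply (continuous_comp f exp); [|apply continuous_exp]
    end ].

Lemma continuous_kdiff l p q : kden p q <> 0 ->
  continuous (fun z : R * R => kdiff l (fst z) (snd z)) (p, q).
Proof.
  intros H.
  apply (continuous_ext (fun z : R * R =>
    exp (l * snd z) *
    ((l * (cos (l * fst z) * cosh (fst z) * sin (snd z) + sin (l * fst z) * sinh (fst z) * cos (snd z))
      + (cos (l * fst z) * cosh (fst z) * cos (snd z) - sin (l * fst z) * sinh (fst z) * sin (snd z)))
       * (sinh (fst z) * sinh (fst z) + sin (snd z) * sin (snd z))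
     - (cos (l * fst z) * cosh (fst z) * sin (snd z) + sin (l * fst z) * sinh (fst z) * cos (snd z))
       * (2 * sin (snd z) * cos (snd z)))
    * (/ kden (fst z) (snd z) * / kden (fst z) (snd z)))).
  - intros z. unfold kdiff, Rdiv. rewrite Rinv_mult. reflexivity.
  - solve_continuous.
Qed.

Lemma continuous_kre l p q : kden p q <> 0 -> continuous (fun p => kre l p q) p.
Proof. intros H. unfold kre, Rdiv. solve_continuous. Qed.

Lemma continuous_kim l p q : kden p q <> 0 -> continuous (fun p => kim l p q) p.
Proof. intros H. unfold kim, Rdiv. solve_continuous. Qed.

Lemma ex_RInt_kre l q a b : 0 < q < PI -> ex_RInt (fun p => kre l p q) a b.
Proof.
  intros Hq. apply (ex_RInt_continuous (V := R_CompleteNormedModule)). intros z _.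
  apply continuous_kre, Rgt_not_eq, kden_pos, Hq.
Qed.

Lemma ex_RInt_kim l q a b : 0 < q < PI -> ex_RInt (fun p => kim l p q) a b.
Proof.
  intros Hq. apply (ex_RInt_continuous (V := R_CompleteNormedModule)). intros z _.
  apply continuous_kim, Rgt_not_eq, kden_pos, Hq.
Qed.

Lemma locally_Ioo (a b x : R) : a < x < b -> locally x (fun y => a < y < b).
Proof.
  intros [Ha Hb]. apply (locally_interval _ x (Finite a) (Finite b)); simpl; auto.
Qed.

(* The derivative is [- kre l r q + kre l 0 q], and [kre] is odd in [p]. *)
Lemma is_derive_RInt_kim l r q : 0 < q < PI ->
  is_derive (fun q => RInt (fun p => kim l p q) 0 r) q (- kre l r q).
Proof.
  intros Hq.
  assert (HD : forall p y, 0 < y < PI -> Derive (fun u => kim l p u) y = kdiff l p y).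
  { intros p y Hy. apply is_derive_unique, is_derive_kim, Rgt_not_eq, kden_pos, Hy. }
  assert (Hloc := locally_Ioo 0 PI q Hq).
  replace (- kre l r q) with (RInt (fun p => Derive (fun u => kim l p u) q) 0 r).
  - apply (is_derive_RInt_param (fun q p => kim l p q)).
    + revert Hloc. apply filter_imp. intros y Hy p _.
      eexists. apply is_derive_kim, Rgt_not_eq, kden_pos, Hy.
    + intros p _. apply continuity_2d_pt_ext_loc with (fun y p => kdiff l p y).
      * apply locally_2d_locally.
        apply (filter_imp (fun z : R * R => 0 < fst z < PI)).
        { intros [y p'] Hy. simpl in *. symmetry. apply HD, Hy. }
        exact (continuous_fst (U := R_UniformSpace) (V := R_UniformSpace) q p _ Hloc).
      * apply continuity_2d_pt_filterlim.
        apply (continuous_comp (fun z : R * R => (snd z, fst z)) (fun z : R * R => kdiff l (fst z) (snd z))).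
        -- apply (continuous_comp_2 snd fst (fun a b => (a, b)) (q, p)).
           apply continuous_snd. apply continuous_fst.
           apply (continuous_ext (fun z : R * R => z)). now intros []. apply continuous_id.
        -- apply continuous_kdiff, Rgt_not_eq, kden_pos, Hq.
    + revert Hloc. apply filter_imp. intros y Hy. apply ex_RInt_kim, Hy.
  - apply is_RInt_unique.
    apply (is_RInt_ext (fun p => kdiff l p q)).
    { intros p _. symmetry. apply HD, Hq. }
    replace (- kre l r q) with (minus (- kre l r q) (- kre l 0 q)).
    + apply (is_RInt_derive (fun p => - kre l p q) (fun p => kdiff l p q)).
      * intros p _. evar_last.
        apply (is_derive_opp (fun p => kre l p q)), is_derive_kre, Rgt_not_eq, kden_pos, Hq.
        unfold opp; simpl. ring.
      * intros p _.
        apply (continuous_comp_2 (fun x => x) (fun _ => q) (fun a b => kdiff l a b) p).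
        apply continuous_id. apply continuous_const.
        apply continuous_kdiff, Rgt_not_eq, kden_pos, Hq.
    + unfold minus, plus, opp; simpl. unfold kre. rewrite sinh_0, (Rmult_0_r l), sin_0.
      unfold Rdiv. ring.
Qed.

(** * Pointwise bounds on the kernel *)

Lemma Rabs_sinh_le p : Rabs (sinh p) <= cosh p.
Proof.
  unfold sinh, cosh. pose proof (exp_pos p). pose proof (exp_pos (-p)).
  apply Rabs_le. lra.
Qed.

(** Covers both numerators: [c] and [s] stand for the trigonometric factors in [l * p], [a] and [b]
    for those in [q], [S] and [C] for [sinh p] and [cosh p]. For [kim] the sine and cosine of
    [l * p] change places. *)
Lemma kernel_trig_le (c s C S a b : R) :
  Rabs c <= 1 -> Rabs s <= 1 -> Rabs a <= 1 -> Rabs b <= 1 -> 0 <= C -> Rabs S <= C ->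
  Rabs (c * S * a - s * C * b) <= 2 * C.
Proof.
  intros Hc Hs Ha Hb HC HS.
  assert (H1 : Rabs (c * S * a) <= C).
  { rewrite !Rabs_mult. pose proof (Rabs_pos c). pose proof (Rabs_pos S). pose proof (Rabs_pos a).
    assert (Rabs c * Rabs S <= C) by nra.
    assert (0 <= Rabs c * Rabs S) by nra. nra. }
  assert (H2 : Rabs (s * C * b) <= C).
  { rewrite !Rabs_mult, (Rabs_pos_eq C HC). pose proof (Rabs_pos s). pose proof (Rabs_pos b).
    assert (Rabs s * C <= C) by nra.
    assert (0 <= Rabs s * C) by nra. nra. }
  unfold Rminus. eapply Rle_trans; [apply Rabs_triang|]. rewrite Rabs_Ropp. lra.
Qed.

Lemma Rabs_sin_le x : Rabs (sin x) <= 1.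
Proof. apply Rabs_le. pose proof (SIN_bound x). lra. Qed.

Lemma Rabs_cos_le x : Rabs (cos x) <= 1.
Proof. apply Rabs_le. pose proof (COS_bound x). lra. Qed.

Lemma exp_mult_le l q : 0 <= q <= PI -> exp (l * q) <= exp (Rabs l * PI).
Proof.
  intros Hq.
  assert (H : l * q <= Rabs l * PI) by (pose proof (Rle_abs l); pose proof (Rabs_pos l); nra).
  destruct H as [H| ->]; [|lra]. apply Rlt_le, exp_increasing, H.
Qed.

Lemma Rabs_exp_frac_le (l q x y d m : R) : 0 < q < PI -> 0 < d <= y -> Rabs x <= 2 * m ->
  Rabs (exp (l * q) * x / y) <= 2 * exp (Rabs l * PI) * (m / d).
Proof.
  intros Hq Hd Hx.
  assert (He := exp_mult_le l q ltac:(lra)). pose proof (exp_pos (l * q)). pose proof (exp_pos (Rabs l * PI)).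
  rewrite Rabs_div, Rabs_mult, (Rabs_pos_eq (exp _)), (Rabs_pos_eq y) by lra.
  replace (2 * exp (Rabs l * PI) * (m / d)) with (exp (Rabs l * PI) * (2 * m) * / d)
    by (unfold Rdiv; ring).
  pose proof (Rabs_pos x).
  unfold Rdiv. apply Rmult_le_compat.
  - nra.
  - apply Rlt_le, Rinv_0_lt_compat; lra.
  - apply Rmult_le_compat; lra.
  - apply Rinv_le_contravar; lra.
Qed.

(** The lower bound [d] of [kden] is left open because two choices matter: [(sin q * cosh p)^2]
    gives decay like [1 / cosh p] for fixed [q], and [sinh p ^ 2] gives a bound uniform in [q]. *)
Lemma Rabs_kre_le l p q d : 0 < q < PI -> 0 < d <= kden p q ->
  Rabs (kre l p q) <= 2 * exp (Rabs l * PI) * (cosh p / d).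
Proof.
  intros Hq Hd. apply Rabs_exp_frac_le; try easy.
  apply kernel_trig_le; try apply Rabs_sin_le; try apply Rabs_cos_le.
  apply Rlt_le, cosh_pos. apply Rabs_sinh_le.
Qed.

Lemma Rabs_kim_le l p q d : 0 < q < PI -> 0 < d <= kden p q ->
  Rabs (kim l p q) <= 2 * exp (Rabs l * PI) * (cosh p / d).
Proof.
  intros Hq Hd. apply Rabs_exp_frac_le; try easy.
  replace (cos (l * p) * cosh p * sin q + sin (l * p) * sinh p * cos q)
    with (sin (l * p) * sinh p * cos q - - cos (l * p) * cosh p * sin q) by ring.
  apply kernel_trig_le; rewrite ?Rabs_Ropp; try apply Rabs_sin_le; try apply Rabs_cos_le.
  apply Rlt_le, cosh_pos. apply Rabs_sinh_le.
Qed.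

(** The difference of the two sides is [(sinh p * cos q)^2]. *)
Lemma kden_ge p q : (sin q * cosh p) * (sin q * cosh p) <= kden p q.
Proof.
  unfold kden.
  replace (sin q * cosh p * (sin q * cosh p)) with (sin q * sin q * (cosh p * cosh p)) by ring.
  rewrite cosh_sqr. pose proof (sin_sqr q). pose proof (Rle_0_sqr (cos q)). pose proof (Rle_0_sqr (sinh p)).
  unfold Rsqr in *. nra.
Qed.

Definition kbound (l q : R) : R := 2 * exp (Rabs l * PI) / (sin q * sin q).

Lemma kbound_pos l q : 0 < q < PI -> 0 < kbound l q.
Proof.
  intros Hq. pose proof (sin_gt_0 q). pose proof (exp_pos (Rabs l * PI)).
  unfold kbound. apply Rdiv_lt_0_compat; nra.
Qed.

Lemma Rabs_kernel_le_sech l p q : 0 < q < PI ->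
  Rabs (kre l p q) <= kbound l q * / cosh p /\ Rabs (kim l p q) <= kbound l q * / cosh p.
Proof.
  intros Hq. pose proof (sin_gt_0 q ltac:(lra) ltac:(lra)). pose proof (cosh_pos p).
  assert (Hd : 0 < sin q * cosh p * (sin q * cosh p) <= kden p q).
  { split; [|apply kden_ge]. assert (0 < sin q * cosh p) by nra. nra. }
  replace (kbound l q * / cosh p)
    with (2 * exp (Rabs l * PI) * (cosh p / (sin q * cosh p * (sin q * cosh p)))).
  - split; [apply Rabs_kre_le | apply Rabs_kim_le]; auto.
  - unfold kbound. field. lra.
Qed.

(** Unlike [kbound], the constant here does not blow up as [sin q] tends to 0. This allows heights
    arbitrarily close to 0 to be compared at one and the same [r]. *)
Lemma Rabs_kre_le_inv l r q : 0 < q < PI -> 1 <= r ->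
  Rabs (kre l r q) <= 4 * exp (Rabs l * PI) * / r.
Proof.
  intros Hq Hr. pose proof (sinh_ge r ltac:(lra)) as Hs.
  eapply Rle_trans; [apply (Rabs_kre_le l r q (sinh r * sinh r)); auto|].
  - unfold kden. pose proof (Rle_0_sqr (sin q)). unfold Rsqr in *. nra.
  - replace (4 * exp (Rabs l * PI) * / r) with (2 * exp (Rabs l * PI) * (2 * / r)) by ring.
    apply Rmult_le_compat_l; [pose proof (exp_pos (Rabs l * PI)); lra|].
    (* Since [sinh r >= r >= 1], [cosh r ^ 2 = 1 + sinh r ^ 2] is at most [2 * sinh r ^ 2]. *)
    assert (Hc : cosh r <= 2 * sinh r).
    { pose proof (cosh_sqr r). pose proof (cosh_pos r). nra. }
    apply Rle_trans with (2 * / sinh r).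
    + apply Rle_trans with (2 * sinh r / (sinh r * sinh r)).
      * apply Rmult_le_compat_r; [|easy]. apply Rlt_le, Rinv_0_lt_compat. nra.
      * right. field. lra.
    + apply Rmult_le_compat_l; [lra|]. apply Rinv_le_contravar; lra.
Qed.

(** * Integrals with arctangent primitives *)

Lemma is_derive_atan_sinh k x : 0 < k ->
  is_derive (fun p => atan (sinh p / k)) x (cosh x * k / (sinh x * sinh x + k * k)).
Proof.
  intros Hk. pose proof (Rle_0_sqr (sinh x)) as H. unfold Rsqr in H.
  evar_last.
  - apply (is_derive_comp atan (fun p => sinh p / k)).
    + apply is_derive_atan.
    + apply (is_derive_ext (fun p => / k * sinh p)); [intros; unfold Rdiv; apply Rmult_comm|].
      apply (is_derive_scal sinh), is_derive_sinh.
  - unfold scal; simpl; unfold mult; simpl. unfold Rsqr.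
    field. repeat split; nra.
Qed.

Lemma is_RInt_poisson k a b : 0 < k ->
  is_RInt (fun p => cosh p * k / (sinh p * sinh p + k * k)) a b (atan (sinh b / k) - atan (sinh a / k)).
Proof.
  intros Hk. apply (is_RInt_derive (fun p => atan (sinh p / k))).
  - intros; apply is_derive_atan_sinh, Hk.
  - intros x _. unfold Rdiv. apply (continuous_mult (fun p => cosh p * k) (fun p => / (sinh p * sinh p + k * k))).
    + solve_continuous.
    + apply (continuous_comp (fun p => sinh p * sinh p + k * k) Rinv).
      * solve_continuous.
      * apply continuous_Rinv. pose proof (Rle_0_sqr (sinh x)) as H. unfold Rsqr in H. nra.
Qed.

(** The case [k = 1] of the Poisson integral, since [sinh p ^ 2 + 1 = cosh p ^ 2]. *)
Lemma is_RInt_sech a b : is_RInt (fun p => / cosh p) a b (atan (sinh b) - atan (sinh a)).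
Proof.
  apply (is_RInt_ext (fun p => cosh p * 1 / (sinh p * sinh p + 1 * 1))).
  - intros x _. pose proof (cosh_sqr x) as H. pose proof (cosh_pos x).
    replace (sinh x * sinh x + 1 * 1) with (cosh x * cosh x) by lra. simpl. field. lra.
  - replace (atan (sinh b) - atan (sinh a)) with (atan (sinh b / 1) - atan (sinh a / 1))
      by (unfold Rdiv; rewrite Rinv_1, !Rmult_1_r; reflexivity).
    apply is_RInt_poisson. lra.
Qed.

Lemma Rabs_atan_lt x : Rabs (atan x) < PI / 2.
Proof. pose proof (atan_bound x). apply Rabs_def1; lra. Qed.

(** The dominating function has the bounded primitive [M / k * atan (sinh (k * x))]. The estimate
    therefore serves both as a bound uniform in the endpoints and as a tail bound when both
    endpoints are far out on the same side. *)
Lemma sech_norm_RInt_le (V : NormedModule R_AbsRing) (f : R -> V) (M k a b : R) (l : V) : 0 < k ->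
  (forall x, norm (f x) <= M * / cosh (k * x)) -> is_RInt f a b l ->
  norm l <= M / k * Rabs (atan (sinh (k * b)) - atan (sinh (k * a))).
Proof.
  intros Hk Hf.
  assert (HM : 0 <= M).
  { specialize (Hf 0). pose proof (norm_ge_0 (f 0)).
    rewrite Rmult_0_r, cosh_0 in Hf. lra. }
  assert (Hg : forall a b, is_RInt (fun x => M * / cosh (k * x)) a b
     (M / k * (atan (sinh (k * b)) - atan (sinh (k * a))))).
  { clear a b. intros a b.
    apply (is_RInt_ext (fun x => scal (M / k) (scal k (/ cosh (k * x + 0))))).
    - intros x _. unfold scal; simpl; unfold mult; simpl. rewrite Rplus_0_r.
      field. split; [|lra]. apply Rgt_not_eq, cosh_pos.
    - apply (is_RInt_scal (V := R_NormedModule)), (is_RInt_comp_lin (fun x => / cosh x)).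
      rewrite !Rplus_0_r. apply is_RInt_sech. }
  assert (H : forall a b l, a <= b -> is_RInt f a b l ->
    norm l <= M / k * Rabs (atan (sinh (k * b)) - atan (sinh (k * a)))).
  { clear a b l. intros a b l Hab Hl. eapply Rle_trans.
    - apply (norm_RInt_le f (fun x => M * / cosh (k * x)) a b l _ Hab (fun x _ => Hf x) Hl (Hg a b)).
    - apply Rmult_le_compat_l; [|apply Rle_abs].
      apply Rdiv_le_0_compat; lra. }
  intros Hl. destruct (Rle_lt_dec a b) as [Hab|Hab]; [apply H; auto|].
  rewrite <- norm_opp, Rabs_minus_sym. apply H; [lra|]. now apply is_RInt_swap.
Qed.

Lemma one_minus_cos_le x : 1 - cos x <= x * x / 2.
Proof.
  (* This is applied at [x / 2], because [1 - cos x = 2 * sin (x / 2) ^ 2]. Beyond [y = 1] the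
     trivial bound on [sin] suffices. *)
  assert (H : forall y, 0 <= y -> sin y * sin y <= y * y).
  { intros y Hy. destruct (Rle_lt_dec y 1) as [H1|H1].
    - destruct Hy as [Hy| <-]; [|rewrite sin_0; lra].
      pose proof (sin_lt_x y Hy). pose proof PI2_1. pose proof (sin_ge_0 y ltac:(lra) ltac:(lra)). nra.
    - pose proof (SIN_bound y). nra. }
  replace x with (2 * (x / 2)) at 1 by field. rewrite cos_2a_sin.
  destruct (Rle_lt_dec 0 (x / 2)) as [Hx|Hx].
  - specialize (H _ Hx). lra.
  - specialize (H (- (x / 2)) ltac:(lra)). rewrite sin_neg in H. lra.
Qed.

(** * The truncated half-line integral of [kim] and its limit *)

Definition kmass (l q r : R) : R := RInt (fun p => kim l p q) 0 r.

Lemma Rabs_kmass_le l q r : 0 < q < PI -> Rabs (kmass l q r) <= kbound l q * PI.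
Proof.
  intros Hq. eapply Rle_trans.
  - apply (sech_norm_RInt_le R_NormedModule (fun p => kim l p q) (kbound l q) 1 0 r (kmass l q r)).
    + lra.
    + intros x. rewrite Rmult_1_l. apply Rabs_kernel_le_sech, Hq.
    + apply (RInt_correct (V := R_CompleteNormedModule)), ex_RInt_kim, Hq.
  - pose proof (kbound_pos l q Hq).
    unfold Rdiv. rewrite Rinv_1, Rmult_1_r. apply Rmult_le_compat_l; [lra|].
    pose proof (atan_bound (sinh (1 * r))). pose proof (atan_bound (sinh (1 * 0))).
    apply Rabs_le. lra.
Qed.

(** The [q]-derivative of [kmass] is the boundary term [- kre l r q], of order [1 / r] uniformly in
    [q], and two heights differ by less than [PI]; the mean value theorem combines the two facts. *)
Lemma kmass_shift_le l q q' r : 0 < q < PI -> 0 < q' < PI -> 1 <= r ->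
  Rabs (kmass l q r - kmass l q' r) <= 4 * PI * exp (Rabs l * PI) * / r.
Proof.
  intros Hq Hq' Hr.
  assert (Hin : forall x, Rmin q' q <= x <= Rmax q' q -> 0 < x < PI).
  { intros x Hx. unfold Rmin, Rmax in Hx. destruct (Rle_dec q' q); lra. }
  assert (Hder : forall x, Rmin q' q <= x <= Rmax q' q ->
    is_derive (fun q => kmass l q r) x (- kre l r x)).
  { intros x Hx. apply is_derive_RInt_kim, Hin, Hx. }
  destruct (MVT_gen (fun q => kmass l q r) q' q (fun q => - kre l r q)) as [c [Hc Heq]].
  - intros x Hx. apply Hder. lra.
  - intros x Hx. apply continuity_pt_filterlim.
    apply (ex_derive_continuous (V := R_NormedModule) (fun q => kmass l q r)).
    exists (- kre l r x). apply Hder, Hx.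
  - rewrite Heq, Rabs_mult, Rabs_Ropp.
    pose proof (Rabs_kre_le_inv l r c (Hin c Hc) Hr).
    replace (4 * PI * exp (Rabs l * PI) * / r) with (4 * exp (Rabs l * PI) * / r * PI) by ring.
    apply Rmult_le_compat; try apply Rabs_pos; auto.
    apply Rabs_le. lra.
Qed.

(** Replacing [q] by [PI - q] keeps [sin q] and [kden] but flips the sign of [cos q]. Once the
    factors [exp (l * q)] and [exp (l * (PI - q))] are removed, the [sin (l * p)] parts cancel and
    the [cos (l * p)] parts double. *)
Lemma kmass_reflect l q r : 0 < q < PI ->
  is_RInt (fun p => cos (l * p) * (cosh p * sin q / kden p q)) 0 r
    ((kmass l q r * exp (- (l * q)) + kmass l (PI - q) r * exp (- (l * (PI - q)))) / 2).
Proof.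
  intros Hq.
  assert (Hq' : 0 < PI - q < PI) by lra.
  apply (is_RInt_ext (fun p => scal (/ 2) (plus (scal (exp (- (l * q))) (kim l p q))
     (scal (exp (- (l * (PI - q)))) (kim l p (PI - q)))))).
  - intros p _. unfold scal, plus; simpl; unfold mult; simpl.
    pose proof (kden_pos p q Hq) as Hd.
    unfold kim. replace (kden p (PI - q)) with (kden p q) by (unfold kden; now rewrite sin_PI_x).
    rewrite sin_PI_x, Rtrigo_facts.cos_pi_minus, !exp_Ropp.
    field. repeat split; try lra; apply Rgt_not_eq, exp_pos.
  - evar_last.
    + apply (is_RInt_scal (V := R_NormedModule)), (is_RInt_plus (V := R_NormedModule));
      apply (is_RInt_scal (V := R_NormedModule)), (RInt_correct (V := R_CompleteNormedModule)), ex_RInt_kim; auto.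
    + unfold scal, plus; simpl; unfold mult; simpl. unfold kmass. field.
Qed.

(* Since [1 - cos (l p)] is at most a multiple of [tanh p ^ 2], the mass defect is
   bounded by a multiple of [sin q] times the integral of [1 / cosh p]. *)
Lemma kmass_defect_le l q r : 0 < q < PI -> 0 <= r ->
  Rabs (kmass l q r * exp (- (l * q)) + kmass l (PI - q) r * exp (- (l * (PI - q)))
        - 2 * atan (sinh r / sin q))
  <= (l * l / 2 + 2) * PI * sin q.
Proof.
  intros Hq Hr. pose proof (sin_gt_0 q ltac:(lra) ltac:(lra)) as Hs.
  set (X := _ + _).
  assert (Hi : is_RInt (fun p => (1 - cos (l * p)) * (cosh p * sin q / kden p q)) 0 r
     (atan (sinh r / sin q) - X / 2)).
  { apply (is_RInt_ext (fun p => minus (cosh p * sin q / (sinh p * sinh p + sin q * sin q))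
      (cos (l * p) * (cosh p * sin q / kden p q)))).
    - intros p _. unfold minus, plus, opp; simpl. fold (kden p q). ring.
    - replace (atan (sinh r / sin q) - X / 2)
        with (minus (atan (sinh r / sin q) - atan (sinh 0 / sin q)) (X / 2)).
      + apply (is_RInt_minus (V := R_NormedModule)).
        * apply is_RInt_poisson, Hs.
        * apply kmass_reflect, Hq.
      + unfold minus, plus, opp; simpl. rewrite sinh_0. unfold Rdiv at 2. rewrite Rmult_0_l, atan_0. ring. }
  assert (Hb := fun H => sech_norm_RInt_le R_NormedModule _ ((l * l / 2 + 2) * sin q) 1 0 r _ Rlt_0_1 H Hi).
  replace (X - 2 * atan (sinh r / sin q)) with (- (2 * (atan (sinh r / sin q) - X / 2))) by field.
  rewrite Rabs_Ropp, Rabs_mult, (Rabs_pos_eq 2) by lra.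
  change (norm (V := R_NormedModule) (atan (sinh r / sin q) - X / 2)) with (Rabs (atan (sinh r / sin q) - X / 2)) in Hb.
  assert (HC : 0 <= (l * l / 2 + 2) * sin q) by (pose proof (Rle_0_sqr l); unfold Rsqr in *; nra).
  enough (Hp : forall p, Rabs ((1 - cos (l * p)) * (cosh p * sin q / kden p q))
       <= (l * l / 2 + 2) * sin q * / cosh (1 * p)).
  { specialize (Hb Hp). rewrite Rmult_0_r, sinh_0, atan_0, Rminus_0_r in Hb.
    pose proof (Rabs_atan_lt (sinh (1 * r))).
    rewrite Rdiv_1_r in Hb.
    apply Rle_trans with (2 * ((l * l / 2 + 2) * sin q * (PI / 2))).
    - apply Rmult_le_compat_l; [lra|]. eapply Rle_trans; [apply Hb|].
      apply Rmult_le_compat_l; lra.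
    - lra. }
  clear Hb Hi. intros p. rewrite Rmult_1_l.
  pose proof (cosh_pos p) as Hc. pose proof (kden_pos p q Hq) as Hd.
  pose proof (COS_bound (l * p)) as Hcos. pose proof (one_minus_cos_le (l * p)) as H1.
  assert (Hp2 : p * p <= sinh p * sinh p).
  { destruct (Rle_lt_dec 0 p) as [H|H].
    - pose proof (sinh_ge p H). nra.
    - pose proof (sinh_ge (- p) ltac:(lra)) as H2.
      rewrite sinh_opp in H2. nra. }
  (* Split [cosh p ^ 2 = 1 + sinh p ^ 2]: against 1 use the quadratic bound on [1 - cos], with
     [p ^ 2 <= sinh p ^ 2], and against [sinh p ^ 2] use [1 - cos <= 2]. *)
  assert (Hmain : (1 - cos (l * p)) * (cosh p * cosh p) <= (l * l / 2 + 2) * kden p q).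
  { rewrite cosh_sqr. unfold kden. pose proof (Rle_0_sqr l). pose proof (Rle_0_sqr (sinh p)).
    pose proof (Rle_0_sqr (sin q)). unfold Rsqr in *.
    assert (1 - cos (l * p) <= l * l / 2 * (sinh p * sinh p)) by nra.
    assert ((1 - cos (l * p)) * (sinh p * sinh p) <= 2 * (sinh p * sinh p)) by nra.
    nra. }
  rewrite Rabs_pos_eq.
  2:{ apply Rmult_le_pos; [lra|]. apply Rdiv_le_0_compat; nra. }
  apply (Rmult_le_reg_r (cosh p * kden p q)); [nra|].
  replace ((1 - cos (l * p)) * (cosh p * sin q / kden p q) * (cosh p * kden p q))
    with ((1 - cos (l * p)) * (cosh p * cosh p) * sin q) by (field; lra).
  replace ((l * l / 2 + 2) * sin q * / cosh p * (cosh p * kden p q))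
    with ((l * l / 2 + 2) * kden p q * sin q) by (field; lra).
  nra.
Qed.

Lemma atan_ge r : 0 < r -> PI / 2 - / r <= atan r.
Proof.
  intros Hr. assert (Hi := Rinv_0_lt_compat r Hr).
  (* Uses [atan (/ r) = PI / 2 - atan r]; the remaining bound holds because the derivative of [atan]
     is at most 1. *)
  enough (atan (/ r) <= / r) by (rewrite atan_inv in H by auto; lra).
  destruct (MVT_gen atan 0 (/ r) (fun x => / (1 + x²))) as [c [Hc Heq]].
  - intros; apply is_derive_atan.
  - intros; apply continuity_pt_filterlim, continuous_atan.
  - rewrite atan_0 in Heq. pose proof (Rle_0_sqr c).
    assert (/ (1 + c²) <= 1) by (rewrite <- Rinv_1 at 2; apply Rinv_le_contravar; lra). nra.
Qed.

(** Because [sinh r / k >= r], the deficit [/ r] is uniform in [k], which later is [sin y] for a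
    small height [y]. *)
Lemma atan_sinh_ge k r : 0 < k <= 1 -> 0 < r -> PI / 2 - / r <= atan (sinh r / k).
Proof.
  intros Hk Hr. pose proof (sinh_ge r ltac:(lra)).
  assert (Hle : r <= sinh r / k).
  { apply (Rmult_le_reg_r k); [lra|]. unfold Rdiv. rewrite Rmult_assoc, Rinv_l by lra. nra. }
  pose proof (atan_ge r Hr).
  destruct Hle as [Hlt| <-]; [|easy]. pose proof (atan_increasing _ _ Hlt). lra.
Qed.

(** The solution [J] of [J * (1 + exp (- l * PI)) = PI], written in terms of [exp (l * PI)] because
    that quantity becomes [t / (2 * PI * n^2)]. *)
Definition kmass_lim (l : R) : R := PI * (exp (l * PI) / (1 + exp (l * PI))).

(** The height [q] is fixed, and the limit is read off at an auxiliary height [y]. First [y] is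
    chosen close to 0, independently of [r]; then [r] is taken large. *)
Lemma kmass_cvg l q (eps : R) : 0 < q < PI -> 0 < eps ->
  exists N, forall r, N < r -> Rabs (kmass l q r - kmass_lim l) < eps.
Proof.
  intros Hq Heps.
  (* [g y] is the factor multiplying the half-line integral once the heights [y] and [PI - y] have
     both been moved to [q]. *)
  set (g := fun y => exp (- (l * y)) + exp (- (l * (PI - y)))).
  set (B := kbound l q * PI). set (C := (l * l / 2 + 2) * PI).
  assert (HB : 0 < B) by (pose proof (kbound_pos l q Hq); pose proof PI_RGT_0; unfold B; nra).
  set (E := exp (Rabs l * PI)). assert (HE : 0 < E) by apply exp_pos.
  assert (Hg0 : g 0 = (1 + exp (l * PI)) / exp (l * PI)).
  { unfold g. rewrite Rmult_0_r, Ropp_0, exp_0, Rminus_0_r, exp_Ropp.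
    field. apply Rgt_not_eq, exp_pos. }
  assert (Hg0pos : 0 < g 0) by (unfold g; pose proof (exp_pos (- (l * 0))); pose proof (exp_pos (- (l * (PI - 0)))); lra).
  assert (Hlim : kmass_lim l * g 0 = PI).
  { rewrite Hg0. unfold kmass_lim. pose proof (exp_pos (l * PI)). field. lra. }
  (* Five errors add up: replacing [g 0] by [g y], the two height shifts (at most [d * E] each), the
     mass defect [C * sin y], and the arctangent deficit [2 * / r]. *)
  assert (Hest : forall y r, 0 < y < PI -> 1 <= r ->
    Rabs (kmass l q r * g 0 - PI) <= (B * Rabs (g y - g 0) + C * sin y) + (8 * PI * (E * E) + 2) * / r).
  { intros y r Hy Hr.
    set (X := kmass l y r * exp (- (l * y)) + kmass l (PI - y) r * exp (- (l * (PI - y)))).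
    set (d := 4 * PI * E * / r).
    pose proof (kmass_shift_le l q y r Hq Hy Hr) as H1. fold E d in H1.
    pose proof (kmass_shift_le l q (PI - y) r Hq ltac:(lra) Hr) as H2. fold E d in H2.
    pose proof (kmass_defect_le l y r Hy ltac:(lra)) as H3. fold X C in H3.
    pose proof (Rabs_kmass_le l q r Hq) as H4. fold B in H4.
    assert (Hexp : forall z, 0 <= z <= PI -> 0 < exp (- (l * z)) <= E).
    { intros z Hz. split; [apply exp_pos|].
      replace (- (l * z)) with (- l * z) by ring. unfold E. rewrite <- (Rabs_Ropp l). now apply exp_mult_le. }
    pose proof (Hexp y ltac:(lra)) as He1. pose proof (Hexp (PI - y) ltac:(lra)) as He2.
    pose proof (sin_gt_0 y ltac:(lra) ltac:(lra)) as Hs. pose proof (SIN_bound y) as Hs1.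
    pose proof (atan_sinh_ge (sin y) r ltac:(lra) ltac:(lra)) as H5.
    pose proof (atan_bound (sinh r / sin y)) as H6.
    replace (kmass l q r * g 0 - PI) with
      (kmass l q r * (g 0 - g y)
       + ((kmass l q r - kmass l y r) * exp (- (l * y))
       + ((kmass l q r - kmass l (PI - y) r) * exp (- (l * (PI - y)))
       + ((X - 2 * atan (sinh r / sin y)) + (2 * atan (sinh r / sin y) - PI)))))
      by (unfold X, g; ring).
    assert (T1 : Rabs (kmass l q r * (g 0 - g y)) <= B * Rabs (g y - g 0)).
    { rewrite Rabs_mult, (Rabs_minus_sym (g 0)). apply Rmult_le_compat_r; [apply Rabs_pos|easy]. }
    assert (T2 : Rabs ((kmass l q r - kmass l y r) * exp (- (l * y))) <= d * E).
    { rewrite Rabs_mult, (Rabs_pos_eq (exp _)) by lra. apply Rmult_le_compat; try lra. apply Rabs_pos. }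
    assert (T3 : Rabs ((kmass l q r - kmass l (PI - y) r) * exp (- (l * (PI - y)))) <= d * E).
    { rewrite Rabs_mult, (Rabs_pos_eq (exp _)) by lra. apply Rmult_le_compat; try lra. apply Rabs_pos. }
    assert (T4 : Rabs (2 * atan (sinh r / sin y) - PI) <= 2 * / r).
    { apply Rabs_le. lra. }
    replace ((8 * PI * (E * E) + 2) * / r) with (d * E + d * E + 2 * / r) by (unfold d; ring).
    pose proof (Rabs_triang (kmass l q r * (g 0 - g y)) ((kmass l q r - kmass l y r) * exp (- (l * y))
       + ((kmass l q r - kmass l (PI - y) r) * exp (- (l * (PI - y)))
       + ((X - 2 * atan (sinh r / sin y)) + (2 * atan (sinh r / sin y) - PI))))).
    pose proof (Rabs_triang ((kmass l q r - kmass l y r) * exp (- (l * y)))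
       ((kmass l q r - kmass l (PI - y) r) * exp (- (l * (PI - y)))
       + ((X - 2 * atan (sinh r / sin y)) + (2 * atan (sinh r / sin y) - PI)))).
    pose proof (Rabs_triang ((kmass l q r - kmass l (PI - y) r) * exp (- (l * (PI - y))))
       ((X - 2 * atan (sinh r / sin y)) + (2 * atan (sinh r / sin y) - PI))).
    pose proof (Rabs_triang (X - 2 * atan (sinh r / sin y)) (2 * atan (sinh r / sin y) - PI)).
    lra. }
  (* The part of the error free of [r] is continuous in [y] and vanishes at [y = 0]. *)
  assert (Hy : exists y, 0 < y < PI /\ B * Rabs (g y - g 0) + C * sin y < eps * g 0 / 2).
  { assert (Hcont : continuous (fun y => B * Rabs (g y - g 0) + C * sin y) 0).
    { assert (continuous (fun y => g y - g 0) 0).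
      { apply (continuous_minus g (fun _ => g 0)); [|apply continuous_const].
        unfold g. apply (ex_derive_continuous (V := R_NormedModule)). auto_derive. easy. }
      apply (continuous_plus (fun y => B * Rabs (g y - g 0)) (fun y => C * sin y)); solve_continuous.
      apply (continuous_comp (fun y => g y - g 0) Rabs); [easy|]. apply continuous_Rabs. }
    assert (He2 : 0 < eps * g 0 / 2) by nra.
    destruct (proj1 (filterlim_locally _ _) Hcont (mkposreal _ He2)) as [d Hd].
    pose proof (cond_pos d) as Hdp. pose proof PI_RGT_0 as HPI.
    exists (Rmin (d / 2) (PI / 2)).
    assert (Hm : 0 < Rmin (d / 2) (PI / 2)) by (apply Rmin_pos; lra).
    pose proof (Rmin_l (d / 2) (PI / 2)). pose proof (Rmin_r (d / 2) (PI / 2)).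
    split; [lra|].
    specialize (Hd (Rmin (d / 2) (PI / 2))).
    assert (Hball : ball 0 d (Rmin (d / 2) (PI / 2))).
    { change (Rabs (Rmin (d / 2) (PI / 2) - 0) < d). rewrite Rminus_0_r, Rabs_pos_eq; lra. }
    specialize (Hd Hball).
    change (Rabs (B * Rabs (g (Rmin (d / 2) (PI / 2)) - g 0) + C * sin (Rmin (d / 2) (PI / 2))
      - (B * Rabs (g 0 - g 0) + C * sin 0)) < eps * g 0 / 2) in Hd.
    rewrite (Rminus_diag (g 0)), Rabs_R0, sin_0, !Rmult_0_r, Rplus_0_r, Rminus_0_r in Hd.
    eapply Rle_lt_trans; [apply Rle_abs|exact Hd]. }
  destruct Hy as [y [Hy Hh]].
  set (K := 8 * PI * (E * E) + 2) in *.
  assert (HK : 0 < K) by (pose proof PI_RGT_0; unfold K; nra).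
  (* Beyond the second entry, [K / r] is below [eps * g 0 / 2]; the entry 1 makes [Hest]
     applicable. *)
  exists (Rmax 1 (2 * K / (eps * g 0))). intros r Hr.
  pose proof (Rmax_l 1 (2 * K / (eps * g 0))). pose proof (Rmax_r 1 (2 * K / (eps * g 0))).
  specialize (Hest y r Hy ltac:(lra)).
  assert (Hprod : 0 < eps * g 0) by nra.
  assert (HKr : K * / r < eps * g 0 / 2).
  { apply (Rmult_lt_reg_r r); [lra|]. rewrite Rmult_assoc, Rinv_l, Rmult_1_r by lra.
    assert (2 * K / (eps * g 0) < r) as Hlt by lra.
    apply (Rmult_lt_compat_r (eps * g 0)) in Hlt; [|easy].
    unfold Rdiv in Hlt. rewrite Rmult_assoc, Rinv_l, Rmult_1_r in Hlt by lra. nra. }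
  apply (Rmult_lt_reg_r (g 0)); [easy|].
  rewrite <- (Rabs_pos_eq (g 0)) at 1 by lra. rewrite <- Rabs_mult, Rmult_minus_distr_r, Hlim.
  lra.
Qed.

(** * Parity in [p] and the integral over the whole line *)

Lemma RInt_kre_opp l q r : 0 < q < PI ->
  RInt (fun p => kre l p q) 0 (- r) = RInt (fun p => kre l p q) 0 r.
Proof.
  intros Hq. symmetry. apply is_RInt_unique.
  apply (is_RInt_ext (fun p => opp (kre l (- p) q))).
  - intros p _. unfold kre, kden, opp; simpl.
    rewrite sinh_opp, cosh_opp, Rmult_opp_opp.
    replace (l * - p) with (- (l * p)) by ring.
    rewrite cos_neg, sin_neg. unfold Rdiv. ring.
  - apply (is_RInt_comp_opp (fun p => kre l p q)). rewrite Ropp_0.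
    apply (RInt_correct (V := R_CompleteNormedModule)), ex_RInt_kre, Hq.
Qed.

Lemma kmass_opp l q r : 0 < q < PI -> kmass l q (- r) = - kmass l q r.
Proof.
  intros Hq. rewrite <- (Ropp_involutive (kmass l q (- r))). f_equal. symmetry.
  apply is_RInt_unique.
  apply (is_RInt_ext (fun p => opp (opp (kim l (- p) q)))).
  - intros p _. unfold kim, kden, opp; simpl.
    rewrite sinh_opp, cosh_opp, Rmult_opp_opp.
    replace (l * - p) with (- (l * p)) by ring.
    rewrite cos_neg, sin_neg. unfold Rdiv. ring.
  - apply (is_RInt_opp (V := R_NormedModule)), (is_RInt_comp_opp (fun p => kim l p q)). rewrite Ropp_0.
    apply (RInt_correct (V := R_CompleteNormedModule)), ex_RInt_kim, Hq.
Qed.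

Lemma RInt_kim_eq l q a b : 0 < q < PI ->
  RInt (fun p => kim l p q) a b = kmass l q b + kmass l q (- a).
Proof.
  intros Hq. rewrite kmass_opp by auto.
  rewrite <- (RInt_Chasles (V := R_CompleteNormedModule) _ a 0 b) by now apply ex_RInt_kim.
  rewrite <- (opp_RInt_swap (V := R_CompleteNormedModule)) by now apply ex_RInt_kim.
  unfold plus, opp, kmass; simpl. ring.
Qed.

(** Oddness of [kre] moves the left endpoint to the other side. As [a] tends to minus infinity and
    [b] to plus infinity independently, the integral becomes a tail between two large positive
    points. *)
Lemma RInt_kre_eq l q a b : 0 < q < PI ->
  RInt (fun p => kre l p q) a b = RInt (fun p => kre l p q) (- a) b.
Proof.
  intros Hq.
  rewrite <- (RInt_Chasles (V := R_CompleteNormedModule) _ a 0 b) by now apply ex_RInt_kre.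
  rewrite <- (RInt_Chasles (V := R_CompleteNormedModule) _ (- a) 0 b) by now apply ex_RInt_kre.
  rewrite <- (opp_RInt_swap (V := R_CompleteNormedModule) _ 0 a) by now apply ex_RInt_kre.
  rewrite <- (opp_RInt_swap (V := R_CompleteNormedModule) _ 0 (- a)) by now apply ex_RInt_kre.
  now rewrite RInt_kre_opp.
Qed.

Lemma Rabs_RInt_kre_le l q a b N : 0 < q < PI -> 0 < N -> N < a -> N < b ->
  Rabs (RInt (fun p => kre l p q) a b) <= kbound l q * / N.
Proof.
  intros Hq HN Ha Hb. eapply Rle_trans.
  - apply (sech_norm_RInt_le R_NormedModule (fun p => kre l p q) (kbound l q) 1 a b).
    + lra.
    + intros x. rewrite Rmult_1_l. apply Rabs_kernel_le_sech, Hq.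
    + apply (RInt_correct (V := R_CompleteNormedModule)), ex_RInt_kre, Hq.
  - pose proof (kbound_pos l q Hq). rewrite Rdiv_1_r, !Rmult_1_l. apply Rmult_le_compat_l; [lra|].
    pose proof (atan_sinh_ge 1 a ltac:(lra) ltac:(lra)) as H1.
    pose proof (atan_sinh_ge 1 b ltac:(lra) ltac:(lra)) as H2.
    rewrite Rdiv_1_r in H1, H2.
    pose proof (atan_bound (sinh a)). pose proof (atan_bound (sinh b)).
    assert (/ a <= / N) by (apply Rinv_le_contravar; lra).
    assert (/ b <= / N) by (apply Rinv_le_contravar; lra).
    apply Rabs_le. lra.
Qed.

(** The kernel in the variable [u] of the line, where [p = k * u]; the factor [k] is the Jacobian,
    so that integrals in [u] are integrals in [p] without a constant. *)
Definition kernel (l q k u : R) : C := (k * kre l (k * u) q, k * kim l (k * u) q).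

Definition kernel_int (l q k : R) (ab : R * R) : C :=
  (RInt (fun p => kre l p q) (k * fst ab) (k * snd ab), RInt (fun p => kim l p q) (k * fst ab) (k * snd ab)).

Lemma is_RInt_kernel l q k a b : 0 < q < PI ->
  is_RInt (kernel l q k) a b (kernel_int l q k (a, b)).
Proof.
  intros Hq. apply (is_RInt_fct_extend_pair (U := R_NormedModule) (V := R_NormedModule)); simpl.
  - apply (is_RInt_ext (fun u => scal k (kre l (k * u + 0) q))).
    { intros u _. rewrite Rplus_0_r. reflexivity. }
    apply (is_RInt_comp_lin (fun p => kre l p q)). rewrite !Rplus_0_r.
    apply (RInt_correct (V := R_CompleteNormedModule)), ex_RInt_kre, Hq.
  - apply (is_RInt_ext (fun u => scal k (kim l (k * u + 0) q))).
    { intros u _. rewrite Rplus_0_r. reflexivity. }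
    apply (is_RInt_comp_lin (fun p => kim l p q)). rewrite !Rplus_0_r.
    apply (RInt_correct (V := R_CompleteNormedModule)), ex_RInt_kim, Hq.
Qed.

Lemma kernel_int_cvg l q k : 0 < q < PI -> 0 < k ->
  filterlim (kernel_int l q k) (filter_prod (Rbar_locally m_infty) (Rbar_locally p_infty))
    (locally ((0, 2 * kmass_lim l) : C)).
Proof.
  intros Hq Hk. apply filterlim_locally. intros eps. pose proof (cond_pos eps) as He.
  destruct (kmass_cvg l q (eps / 2) Hq ltac:(lra)) as [N HN].
  pose proof (kbound_pos l q Hq) as HM.
  (* The second entry makes the tail bound [kbound l q * / N'] of the real part at most
     [eps / 2]. *)
  set (N' := Rmax N (2 * kbound l q / eps)).
  pose proof (Rmax_l N (2 * kbound l q / eps)). pose proof (Rmax_r N (2 * kbound l q / eps)). fold N' in H, H0.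
  assert (HN' : 0 < 2 * kbound l q / eps) by (apply Rdiv_lt_0_compat; lra).
  apply (Filter_prod _ _ _ (fun a => a < - (N' / k)) (fun b => N' / k < b)).
  - now exists (- (N' / k)).
  - now exists (N' / k).
  - intros a b Ha Hb.
    assert (Hscale : forall z, N' / k < z -> N' < k * z).
    { intros z Hz. apply (Rmult_lt_compat_l k) in Hz; [|easy].
      replace (k * (N' / k)) with N' in Hz by (field; lra). easy. }
    assert (Hb' := Hscale b Hb). assert (Ha' := Hscale (- a) ltac:(lra)).
    replace (k * - a) with (- (k * a)) in Ha' by ring.
    split; simpl.
    + change (Rabs (RInt (fun p => kre l p q) (k * a) (k * b) - 0) < eps).
      rewrite Rminus_0_r, RInt_kre_eq by easy.
      eapply Rle_lt_trans; [apply (Rabs_RInt_kre_le l q _ _ N'); auto; lra|].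
      apply Rle_lt_trans with (eps / 2); [|lra].
      apply (Rmult_le_reg_r N'); [lra|]. rewrite Rmult_assoc, Rinv_l, Rmult_1_r by lra.
      apply (Rmult_le_compat_r eps) in H0; [|lra].
      unfold Rdiv in H0. rewrite Rmult_assoc, Rinv_l, Rmult_1_r in H0 by lra. lra.
    + change (Rabs (RInt (fun p => kim l p q) (k * a) (k * b) - 2 * kmass_lim l) < eps).
      rewrite RInt_kim_eq by easy.
      replace (kmass l q (k * b) + kmass l q (- (k * a)) - 2 * kmass_lim l)
        with ((kmass l q (k * b) - kmass_lim l) + (kmass l q (- (k * a)) - kmass_lim l)) by ring.
      eapply Rle_lt_trans; [apply Rabs_triang|].
      pose proof (HN (k * b) ltac:(lra)). pose proof (HN (- (k * a)) ltac:(lra)). lra.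
Qed.

(** * Convergence and remainders of dominated series *)

(** An integral test: by the mean value theorem for [F x = x ^ (1 - s)], each term is dominated by a
    difference of consecutive values of [F / d], and these telescope. *)
Lemma ex_series_zeta s : 1 < s -> ex_series (fun n => exp (- s * ln (INR (S n)))).
Proof.
  intros Hs. set (d := s - 1). assert (Hd : 0 < d) by (unfold d; lra).
  set (F := fun x => exp (- d * ln x)).
  assert (Hpos : forall n, 0 < INR (S n)) by (intros n; apply lt_0_INR; lia).
  assert (HF : forall x, 0 < x -> is_derive F x (- d * exp (- s * ln x))).
  { intros x Hx. unfold F. auto_derive; [easy|].
    replace (- s * ln x) with (- d * ln x + - ln x) by (unfold d; ring).
    rewrite exp_plus, exp_Ropp, exp_ln by easy. unfold d. ring. }
  (* The term at [n + 2] is compared with the interval from [n + 1] to [n + 2], so the first term of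
     the series is set aside. *)
  apply (ex_series_incr_1 (V := R_NormedModule)).
  apply (ex_series_le (V := R_CompleteNormedModule) _ (fun n => / d * (F (INR (S n)) - F (INR (S (S n)))))).
  - intros n. change (Rabs (exp (- s * ln (INR (S (S n))))) <= / d * (F (INR (S n)) - F (INR (S (S n))))).
    rewrite Rabs_pos_eq by (apply Rlt_le, exp_pos).
    assert (Hlt : INR (S n) < INR (S (S n))) by (apply lt_INR; lia).
    destruct (MVT_gen F (INR (S n)) (INR (S (S n))) (fun x => - d * exp (- s * ln x))) as [c [Hc Heq]].
    + intros x Hx. rewrite Rmin_left, Rmax_right in Hx by lra. apply HF. specialize (Hpos n). lra.
    + intros x Hx. rewrite Rmin_left, Rmax_right in Hx by lra.
      apply continuity_pt_filterlim, (ex_derive_continuous (V := R_NormedModule)).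
      eexists. apply HF. specialize (Hpos n). lra.
    + rewrite Rmin_left, Rmax_right in Hc by lra. specialize (Hpos n).
      replace (INR (S (S n)) - INR (S n)) with 1 in Heq by (rewrite (S_INR (S n)); ring).
      replace (/ d * (F (INR (S n)) - F (INR (S (S n))))) with (exp (- s * ln c)).
      * destruct (Rle_lt_or_eq_dec _ _ (proj2 Hc)) as [Hcl| ->]; [|lra].
        apply Rlt_le, exp_increasing. pose proof (ln_increasing c (INR (S (S n))) ltac:(lra) Hcl). nra.
      * replace (F (INR (S n)) - F (INR (S (S n)))) with (d * exp (- s * ln c)) by lra.
        field. lra.
  - exists (/ d * F 1).
    assert (Hsum : forall N, sum_n (fun n => / d * (F (INR (S n)) - F (INR (S (S n))))) N
       = / d * (F 1 - F (INR (S (S N))))).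
    { induction N as [|N IH].
      - rewrite sum_O. simpl. ring.
      - rewrite sum_Sn, IH. unfold plus; simpl plus.
        change (/ d * (F 1 - F (INR (S (S N)))) + / d * (F (INR (S (S N))) - F (INR (S (S (S N)))))
          = / d * (F 1 - F (INR (S (S (S N)))))). ring. }
    change (is_lim_seq (sum_n (fun n => / d * (F (INR (S n)) - F (INR (S (S n)))))) (/ d * F 1)).
    apply (is_lim_seq_ext (fun N => / d * (F 1 - F (INR (S (S N)))))); [easy|].
    replace (Finite (/ d * F 1)) with (Rbar_mult (/ d) (F 1 - 0)) by (simpl; f_equal; ring).
    apply is_lim_seq_scal_l. apply is_lim_seq_minus'; [apply is_lim_seq_const|].
    apply -> (is_lim_seq_incr_1 (fun n => F (INR (S n)))).
    apply -> (is_lim_seq_incr_1 (fun n => F (INR n))).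
    apply (is_lim_comp_seq F INR p_infty (Finite 0)).
    + unfold F. apply (is_lim_comp exp (fun x => - d * ln x) p_infty 0 m_infty).
      * apply is_lim_exp_m.
      * replace m_infty with (Rbar_mult (- d) p_infty).
        -- apply is_lim_scal_l, is_lim_ln_p.
        -- simpl. destruct (Rle_dec 0 (- d)); [exfalso; lra|easy].
      * exists 0. easy.
    + exists 0%nat. easy.
    + apply is_lim_seq_INR.
Qed.

Lemma Series_tail_le (a b : nat -> R) (N : nat) :
  (forall n, Rabs (b n) <= a n) -> ex_series a ->
  Rabs (Series b - sum_n b N) <= Series a - sum_n a N.
Proof.
  intros Hab Ha.
  assert (Hb : ex_series (fun n => Rabs (b n))).
  { apply (ex_series_le (V := R_CompleteNormedModule) _ a); [|easy].
    intros n. change (Rabs (Rabs (b n)) <= a n). now rewrite Rabs_Rabsolu. }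
  rewrite (Series_incr_n b (S N)), (Series_incr_n a (S N)); auto with arith.
  2: now apply ex_series_Rabs.
  simpl Nat.pred. rewrite !sum_n_Reals.
  replace (sum_f_R0 b N + Series (fun k => b (S N + k)%nat) - sum_f_R0 b N)
    with (Series (fun k => b (S N + k)%nat)) by ring.
  replace (sum_f_R0 a N + Series (fun k => a (S N + k)%nat) - sum_f_R0 a N)
    with (Series (fun k => a (S N + k)%nat)) by ring.
  eapply Rle_trans; [apply Series_Rabs|apply Series_le].
  - now apply (ex_series_incr_n (V := R_NormedModule) (fun n => Rabs (b n)) (S N)).
  - intros n. split; [apply Rabs_pos|apply Hab].
  - now apply (ex_series_incr_n (V := R_NormedModule) a (S N)).
Qed.

(** * The integrand along the line as a Dirichlet series of kernels *)

Lemma cexp_plus z w : cexp (z + w)%C = (cexp z * cexp w)%C.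
Proof.
  unfold cexp, Cmult, Cplus, Re, Im; simpl. rewrite exp_plus, cos_plus, sin_plus.
  f_equal; ring.
Qed.

Lemma Cmod_cexp z : Cmod (cexp z) = exp (Re z).
Proof.
  unfold Cmod, cexp; simpl.
  replace (_ + _) with (exp (Re z) * exp (Re z)).
  - apply sqrt_square, Rlt_le, exp_pos.
  - pose proof (sin_sqr (Im z)).
    transitivity (exp (Re z) * exp (Re z) * (cos (Im z) * cos (Im z) + sin (Im z) * sin (Im z))); [|ring].
    rewrite H. ring.
Qed.

Lemma csinh_eq p q : csinh (p, - q) = (sinh p * cos q, - (cosh p * sin q)).
Proof.
  unfold csinh, cexp, Cdiv, Cinv, Cminus, Copp, Cplus, Cmult, Re, Im, sinh, cosh; simpl.
  rewrite Ropp_involutive, cos_neg, sin_neg. f_equal; field.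
Qed.

Definition line (sigma u : R) : C := (u, - sigma).

(** The integrand without its zeta factor. The base [a] is free because multiplying by the
    [n]-dependent power only changes it from [t / (2 * PI)] to [t / (2 * PI * n^2)]. *)
Definition weight (a sigma u : R) : C :=
  (rcpow a (Ci * line sigma u / 2) * (RtoC PI / (2 * csinh (RtoC PI * line sigma u / 2))))%C.

(** Put [z = PI * x / 2 = p - i q]: then [a ^ (i x / 2) = exp (i l z)] with [l = ln a / PI], and the
    remaining factor is [(PI / 2) / sinh z]. The strip [0 < sigma < 2] is exactly [0 < q < PI]. *)
Lemma weight_eq a sigma u : 0 < sigma < 2 ->
  weight a sigma u = kernel (ln a / PI) (PI / 2 * sigma) (PI / 2) u.
Proof.
  intros Hs. pose proof PI_RGT_0 as HPI.
  set (p := PI / 2 * u). set (q := PI / 2 * sigma).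
  assert (Hq : 0 < q < PI) by (unfold q; split; nra).
  pose proof (kden_pos p q Hq) as Hd.
  unfold weight, kernel. fold p.
  replace (RtoC PI * line sigma u / 2)%C with ((p, - q) : C).
  2:{ unfold line, p, q, Cdiv, Cinv, Cmult, RtoC; simpl. f_equal; field. }
  rewrite csinh_eq.
  replace (rcpow a (Ci * line sigma u / 2)) with
    ((exp (ln a / PI * q) * cos (ln a / PI * p), exp (ln a / PI * q) * sin (ln a / PI * p)) : C).
  2:{ unfold rcpow, cexp, line, p, q, Ci, Cdiv, Cinv, Cmult, RtoC, Re, Im; simpl.
      f_equal; f_equal; f_equal; field; lra. }
  replace (RtoC PI / (2 * ((sinh p * cos q)%R, (- (cosh p * sin q))%R)))%C
    with ((PI / 2 * (sinh p * cos q) / kden p q, PI / 2 * (cosh p * sin q) / kden p q) : C).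
  - unfold Cmult, kre, kim; simpl. f_equal; field; lra.
  - assert (Hk : kden p q = sinh p * cos q * (sinh p * cos q) + cosh p * sin q * (cosh p * sin q)).
    { unfold kden. pose proof (cosh_sqr p) as H1. pose proof (sin_sqr q) as H2. ring [H1 H2]. }
    rewrite Hk in *. unfold Cdiv, Cinv, Cmult, RtoC; simpl. f_equal; field; split; nra.
Qed.

Lemma Cmod_le_Rabs z : Cmod z <= Rabs (Re z) + Rabs (Im z).
Proof.
  unfold Cmod, Re, Im. pose proof (Rabs_pos (fst z)). pose proof (Rabs_pos (snd z)).
  apply Rsqr_incr_0_var; [|lra]. rewrite Rsqr_sqrt by nra.
  pose proof (Rsqr_abs (fst z)). pose proof (Rsqr_abs (snd z)). unfold Rsqr in *. nra.
Qed.

Lemma Cmod_kernel_le l q k u : 0 < q < PI -> 0 < k ->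
  Cmod (kernel l q k u) <= 2 * k * kbound l q * / cosh (k * u).
Proof.
  intros Hq Hk. eapply Rle_trans; [apply Cmod_le_Rabs|]. unfold kernel, Re, Im; simpl.
  rewrite !Rabs_mult, (Rabs_pos_eq k) by lra.
  destruct (Rabs_kernel_le_sech l (k * u) q Hq) as [H1 H2]. nra.
Qed.

(** The part of [n ^ (- s)] depending on [x] is [n ^ (- i x) = (n ^ (-2)) ^ (i x / 2)], which the
    base of the weight absorbs. *)
Lemma zeta_term_weight t sigma u n : 0 < t ->
  (zeta_term (RtoC (1 / 2) + Ci * (RtoC t + line sigma u)) n * weight (t / (2 * PI)) sigma u)%C
  = (rcpow (INR (S n)) (- (RtoC (1 / 2) + Ci * RtoC t)) * weight (t / (2 * PI * INR (S n) ^ 2)) sigma u)%C.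
Proof.
  intros Ht. pose proof PI_RGT_0 as HPI.
  assert (Hn : 0 < INR (S n)) by (apply lt_0_INR; lia).
  unfold weight. rewrite !Cmult_assoc. f_equal.
  unfold zeta_term, rcpow. rewrite <- !cexp_plus. f_equal.
  replace (ln (t / (2 * PI * INR (S n) ^ 2))) with (ln (t / (2 * PI)) - 2 * ln (INR (S n))).
  - generalize (ln (t / (2 * PI))) (ln (INR (S n))). intros a b.
    unfold line, Ci, Cdiv, Cinv, Copp, Cplus, Cmult, RtoC; simpl. f_equal; field.
  - replace (t / (2 * PI * INR (S n) ^ 2)) with (t / (2 * PI) * / (INR (S n) * INR (S n)))
      by (field; lra).
    rewrite ln_mult, ln_Rinv, ln_mult; try nra.
    + apply Rdiv_lt_0_compat; lra.
    + apply Rinv_0_lt_compat. nra.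
Qed.

Lemma G_integrand_eq t sigma u :
  G_integrand t sigma u
  = (zeta (RtoC (1 / 2) + Ci * (RtoC t + line sigma u)) * weight (t / (2 * PI)) sigma u)%C.
Proof. unfold G_integrand, weight, line. ring. Qed.

Lemma Cmod_zeta_term s n : Cmod (zeta_term s n) = exp (- Re s * ln (INR (S n))).
Proof.
  unfold zeta_term, rcpow. rewrite Cmod_cexp. f_equal. unfold Re; simpl. ring.
Qed.

Lemma Re_sum_n (f : nat -> C) N :
  Re (sum_n (G := C_AbelianMonoid) f N) = sum_n (fun n => Re (f n)) N.
Proof. induction N as [|N IH]; [now rewrite !sum_O|]. rewrite !sum_Sn, <- IH. reflexivity. Qed.

Lemma Im_sum_n (f : nat -> C) N :
  Im (sum_n (G := C_AbelianMonoid) f N) = sum_n (fun n => Im (f n)) N.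
Proof. induction N as [|N IH]; [now rewrite !sum_O|]. rewrite !sum_Sn, <- IH. reflexivity. Qed.

(** The remainder of the series of absolute values. It depends on the real part alone and is
    therefore constant along the line of integration. *)
Definition zeta_tail (s : R) (N : nat) : R :=
  Series (fun n => exp (- s * ln (INR (S n)))) - sum_n (fun n => exp (- s * ln (INR (S n)))) N.

(** The factor 2 comes from estimating the real and imaginary parts separately. *)
Lemma zeta_tail_bound s N : 1 < Re s ->
  Cmod (zeta s - sum_n (G := C_AbelianMonoid) (zeta_term s) N) <= 2 * zeta_tail (Re s) N.
Proof.
  intros Hs. eapply Rle_trans; [apply Cmod_le_Rabs|].
  assert (Hex := ex_series_zeta _ Hs).
  assert (H1 : Rabs (Series (fun n => Re (zeta_term s n)) - sum_n (fun n => Re (zeta_term s n)) N)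
     <= zeta_tail (Re s) N).
  { apply Series_tail_le; [|easy]. intros n. rewrite <- Cmod_zeta_term.
    eapply Rle_trans; [apply Rmax_l|apply Rmax_Cmod]. }
  assert (H2 : Rabs (Series (fun n => Im (zeta_term s n)) - sum_n (fun n => Im (zeta_term s n)) N)
     <= zeta_tail (Re s) N).
  { apply Series_tail_le; [|easy]. intros n. rewrite <- Cmod_zeta_term.
    eapply Rle_trans; [apply Rmax_r|apply Rmax_Cmod]. }
  rewrite <- Re_sum_n in H1. rewrite <- Im_sum_n in H2.
  unfold Cminus, Cplus, Copp, Re, Im in *; simpl in *. unfold Rminus in *. lra.
Qed.

Lemma zeta_tail_ge0 s N : 1 < s -> 0 <= zeta_tail s N.
Proof.
  intros Hs. eapply Rle_trans; [apply Rabs_pos|].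
  apply (Series_tail_le _ (fun n => exp (- s * ln (INR (S n))))).
  - intros n. rewrite Rabs_pos_eq; [apply Rle_refl|apply Rlt_le, exp_pos].
  - now apply ex_series_zeta.
Qed.

Lemma zeta_tail_cvg s (eps : R) : 1 < s -> 0 < eps ->
  eventually (fun N => zeta_tail s N < eps).
Proof.
  intros Hs Heps.
  pose proof (Series_correct _ (ex_series_zeta s Hs)) as H.
  generalize (proj1 (filterlim_locally _ _) H (mkposreal _ Heps)).
  apply filter_imp. intros N HN.
  change (Rabs (sum_n (fun n => exp (- s * ln (INR (S n)))) N - Series (fun n => exp (- s * ln (INR (S n))))) < eps) in HN.
  apply Rabs_lt_between in HN. unfold zeta_tail. lra.
Qed.

(** * Complex-valued integrals and finite sums *)

Lemma is_RInt_Cmult_l (c : C) (f : R -> C) (a b : R) (l : C) :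
  is_RInt f a b l -> is_RInt (fun u => c * f u)%C a b (c * l)%C.
Proof.
  intros H.
  pose proof (is_RInt_fct_extend_fst (U := R_NormedModule) (V := R_NormedModule) f a b l H) as H1.
  pose proof (is_RInt_fct_extend_snd (U := R_NormedModule) (V := R_NormedModule) f a b l H) as H2.
  apply (is_RInt_fct_extend_pair (U := R_NormedModule) (V := R_NormedModule)); simpl.
  - apply (is_RInt_minus (V := R_NormedModule) (fun u => fst c * fst (f u)) (fun u => snd c * snd (f u)));
      now apply (is_RInt_scal (V := R_NormedModule)).
  - apply (is_RInt_plus (V := R_NormedModule) (fun u => fst c * snd (f u)) (fun u => snd c * fst (f u)));
      now apply (is_RInt_scal (V := R_NormedModule)).
Qed.

Lemma is_RInt_sum_n (f : nat -> R -> C) (I : nat -> C) (a b : R) (N : nat) :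
  (forall n, is_RInt (f n) a b (I n)) ->
  is_RInt (fun u => sum_n (G := C_AbelianMonoid) (fun n => f n u) N) a b
    (sum_n (G := C_AbelianMonoid) I N).
Proof.
  intros H. induction N as [|N IH].
  - rewrite sum_O. apply (is_RInt_ext (f 0%nat)); [|easy]. intros u _. now rewrite sum_O.
  - rewrite sum_Sn.
    apply (is_RInt_ext (fun u => plus (G := C_AbelianMonoid) (sum_n (G := C_AbelianMonoid) (fun n => f n u) N) (f (S N) u))).
    + intros u _. now rewrite sum_Sn.
    + apply (is_RInt_plus (V := C_R_NormedModule)); easy.
Qed.

Lemma filterlim_sum_n_Cmult (T : Type) (F : (T -> Prop) -> Prop) (FF : Filter F)
    (c : nat -> C) (f : nat -> T -> C) (l : nat -> C) (N : nat) :
  (forall n, filterlim (f n) F (locally (l n))) ->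
  filterlim (fun x => sum_n (G := C_AbelianMonoid) (fun n => c n * f n x)%C N) F
    (locally (sum_n (G := C_AbelianMonoid) (fun n => c n * l n)%C N)).
Proof.
  intros H.
  assert (Hc : forall n, filterlim (fun x => c n * f n x)%C F (locally (c n * l n)%C)).
  { intros n. apply (filterlim_comp _ _ _ (f n) (fun z => c n * z)%C F (locally (l n))); [easy|].
    apply (filterlim_scal_r (K := C_AbsRing) (V := C_NormedModule)). }
  induction N as [|N IH].
  - rewrite sum_O. eapply filterlim_ext; [|apply Hc]. intros x. now rewrite sum_O.
  - rewrite sum_Sn. eapply filterlim_ext.
    { intros x. symmetry. apply sum_Sn. }
    exact (filterlim_comp_2 _ _ _ IH (Hc (S N))
             (filterlim_plus (K := C_AbsRing) (V := C_NormedModule) _ _)).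
Qed.

Lemma sum_n_Cmult_r (f : nat -> C) (c : C) N :
  (sum_n (G := C_AbelianMonoid) f N * c)%C = sum_n (G := C_AbelianMonoid) (fun n => f n * c)%C N.
Proof.
  induction N as [|N IH]; [now rewrite !sum_O|].
  rewrite !sum_Sn, <- IH. unfold plus; simpl. ring.
Qed.

Lemma ball_C_of_Cmod (x y : C) (eps : posreal) : Cmod (x - y) < eps -> ball x eps y.
Proof.
  intros H. pose proof (Rmax_Cmod (x - y)%C) as Hm.
  assert (H1 := Rle_lt_trans _ _ _ (Rle_trans _ _ _ (Rmax_l _ _) Hm) H).
  assert (H2 := Rle_lt_trans _ _ _ (Rle_trans _ _ _ (Rmax_r _ _) Hm) H).
  split.
  - change (Rabs (fst y - fst x) < eps). rewrite Rabs_minus_sym. exact H1.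
  - change (Rabs (snd y - snd x) < eps). rewrite Rabs_minus_sym. exact H2.
Qed.

(** Independent of [a] and [b], which makes the convergence of the partial sums uniform in the
    endpoints. The values of [atan] differ by at most [PI], and the two components account for the
    factor 2. *)
Lemma sech_Cmod_RInt_le (f : R -> C) (M k a b : R) (l : C) : 0 < k ->
  (forall x, Cmod (f x) <= M * / cosh (k * x)) -> is_RInt f a b l ->
  Cmod l <= 2 * (M / k * PI).
Proof.
  intros Hk Hf Hl.
  assert (HM : 0 <= M / k).
  { specialize (Hf 0). pose proof (Cmod_ge_0 (f 0)). rewrite Rmult_0_r, cosh_0, Rinv_1 in Hf.
    apply Rdiv_le_0_compat; lra. }
  assert (Hat : M / k * Rabs (atan (sinh (k * b)) - atan (sinh (k * a))) <= M / k * PI).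
  { apply Rmult_le_compat_l; [easy|].
    pose proof (atan_bound (sinh (k * b))). pose proof (atan_bound (sinh (k * a))).
    apply Rabs_le. lra. }
  eapply Rle_trans; [apply Cmod_le_Rabs|].
  assert (H1 : Rabs (Re l) <= M / k * Rabs (atan (sinh (k * b)) - atan (sinh (k * a)))).
  { apply (sech_norm_RInt_le R_NormedModule (fun u => fst (f u))); [easy| |].
    - intros x. eapply Rle_trans; [|apply Hf].
      eapply Rle_trans; [apply Rmax_l|apply Rmax_Cmod].
    - now apply (is_RInt_fct_extend_fst (U := R_NormedModule) (V := R_NormedModule)). }
  assert (H2 : Rabs (Im l) <= M / k * Rabs (atan (sinh (k * b)) - atan (sinh (k * a)))).
  { apply (sech_norm_RInt_le R_NormedModule (fun u => snd (f u))); [easy| |].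
    - intros x. eapply Rle_trans; [|apply Hf].
      eapply Rle_trans; [apply Rmax_r|apply Rmax_Cmod].
    - now apply (is_RInt_fct_extend_snd (U := R_NormedModule) (V := R_NormedModule)). }
  lra.
Qed.

(** * Value of each term, and exchange of sum and integral *)

(** With [D = 2 * PI * n^2], [exp (l * PI) = t / D], so [kmass_lim] is [PI * (t / D) / (1 + t / D) =
    PI * t / (D + t)]. *)
Lemma kmass_lim_term t n : 0 < t ->
  (rcpow (INR (S n)) (- (RtoC (1 / 2) + Ci * RtoC t))
    * (0%R, (2 * kmass_lim (ln (t / (2 * PI * INR (S n) ^ 2)) / PI))%R))%C
  = (2 * RtoC PI * Ci * G_rhs_term t n)%C.
Proof.
  intros Ht. pose proof PI_RGT_0 as HPI.
  assert (Hn : 0 < INR (S n)) by (apply lt_0_INR; lia).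
  assert (Hn2 : 0 < 2 * PI * INR (S n) ^ 2) by (assert (0 < INR (S n) ^ 2) by (apply pow_lt; easy); nra).
  unfold G_rhs_term. set (c := rcpow _ _).
  replace ((0, 2 * kmass_lim (ln (t / (2 * PI * INR (S n) ^ 2)) / PI)) : C)
    with (2 * RtoC PI * Ci * RtoC (t / (2 * PI * INR (S n) ^ 2 + t)))%C; [ring|].
  unfold kmass_lim.
  replace (ln (t / (2 * PI * INR (S n) ^ 2)) / PI * PI) with (ln (t / (2 * PI * INR (S n) ^ 2)))
    by (field; lra).
  rewrite exp_ln by (apply Rdiv_lt_0_compat; lra).
  revert Hn2. generalize (2 * PI * INR (S n) ^ 2). intros D HD.
  unfold Ci, Cmult, RtoC; simpl. f_equal; field; lra.
Qed.

Theorem mainTheorem8 :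
  forall t sigma : R, 0 < t -> 1/2 < sigma < 2 ->
  exists (I S : C),
    is_RInt_gen (G_integrand t sigma) (Rbar_locally m_infty) (Rbar_locally p_infty) I /\
    is_series (G_rhs_term t) S /\
    (I / (2 * RtoC PI * Ci))%C = S.
Proof.
  intros t sigma Ht Hsigma. pose proof PI_RGT_0 as HPI.
  set (k := PI / 2). assert (Hk : 0 < k) by (unfold k; lra).
  set (q := k * sigma). assert (Hq : 0 < q < PI) by (unfold q, k; split; nra).
  set (c := fun n => rcpow (INR (S n)) (- (RtoC (1 / 2) + Ci * RtoC t))).
  set (l := fun n => ln (t / (2 * PI * INR (S n) ^ 2)) / PI).
  set (s := fun u => (RtoC (1 / 2) + Ci * (RtoC t + line sigma u))%C).
  (* The constant real part of the zeta argument; [1/2 < sigma] places it in the half-plane of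
     absolute convergence. *)
  set (sr := 1 / 2 + sigma). assert (Hsr : 1 < sr) by (unfold sr; lra).
  assert (Hs : forall u, Re (s u) = sr).
  { intros u. unfold s, sr, line, Re, Ci, Cmult, Cplus, RtoC; simpl. ring. }
  set (f := fun N u => sum_n (G := C_AbelianMonoid) (fun n => c n * kernel (l n) q k u)%C N).
  set (h := fun N ab => sum_n (G := C_AbelianMonoid) (fun n => c n * kernel_int (l n) q k ab)%C N).
  (* The remainder of the zeta series multiplies the single weight of base [t / (2 * PI)], so one
     constant serves for all [N]. *)
  set (M := 2 * k * kbound (ln (t / (2 * PI)) / PI) q).
  assert (HM : 0 < M) by (pose proof (kbound_pos (ln (t / (2 * PI)) / PI) q Hq); unfold M; nra).
  assert (Hdiff : forall N u,
    Cmod (G_integrand t sigma u - f N u) <= 2 * zeta_tail sr N * M * / cosh (k * u)).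
  { intros N u.
    replace (G_integrand t sigma u - f N u)%C
      with ((zeta (s u) - sum_n (G := C_AbelianMonoid) (zeta_term (s u)) N)
            * weight (t / (2 * PI)) sigma u)%C.
    - rewrite Cmod_mult, Rmult_assoc. apply Rmult_le_compat; try apply Cmod_ge_0.
      + rewrite <- (Hs u). apply zeta_tail_bound. now rewrite Hs.
      + rewrite weight_eq by lra. now apply Cmod_kernel_le.
    - rewrite G_integrand_eq. fold (s u).
      replace (f N u) with (sum_n (G := C_AbelianMonoid) (zeta_term (s u)) N * weight (t / (2 * PI)) sigma u)%C.
      + ring.
      + rewrite sum_n_Cmult_r. apply sum_n_ext. intros n.
        unfold s. rewrite zeta_term_weight by easy. rewrite weight_eq by lra. reflexivity. }
  assert (Hfh : forall N a b, is_RInt (f N) a b (h N (a, b))).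
  { intros N a b. apply is_RInt_sum_n. intros n. now apply is_RInt_Cmult_l, is_RInt_kernel. }
  assert (Hf : filterlim f eventually (locally (G_integrand t sigma : fct_UniformSpace R C_UniformSpace))).
  { apply (filterlim_locally (U := fct_UniformSpace R C_UniformSpace) f (G_integrand t sigma)). intros eps.
    assert (He : 0 < eps / (2 * M)) by (apply Rdiv_lt_0_compat; [apply cond_pos|lra]).
    generalize (zeta_tail_cvg sr _ Hsr He). apply filter_imp. intros N HN u.
    apply ball_C_of_Cmod. eapply Rle_lt_trans; [apply Hdiff|].
    assert (Hc1 : / cosh (k * u) <= 1).
    { rewrite <- Rinv_1. apply Rinv_le_contravar; [lra|].
      pose proof (cosh_sqr (k * u)). pose proof (cosh_pos (k * u)). nra. }
    assert (Hz : 0 <= 2 * zeta_tail sr N * M) by (pose proof (zeta_tail_ge0 sr N Hsr); nra).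
    apply Rle_lt_trans with (2 * zeta_tail sr N * M); [nra|].
    apply (Rmult_lt_compat_r (2 * M)) in HN; [|lra].
    replace (eps / (2 * M) * (2 * M)) with (pos eps) in HN by (field; lra). lra. }
  set (g := fun ab : R * R => RInt (V := C_R_CompleteNormedModule) (G_integrand t sigma) (fst ab) (snd ab)).
  (* Integrability on bounded intervals is inherited from the partial sums through their uniform
     convergence. *)
  assert (Hg : forall a b, is_RInt (G_integrand t sigma) a b (g (a, b))).
  { intros a b. apply (RInt_correct (V := C_R_CompleteNormedModule)).
    destruct (filterlim_RInt (V := C_R_CompleteNormedModule) f a b eventually _ (G_integrand t sigma)
      (fun N => h N (a, b)) (fun N => Hfh N a b) Hf) as [If [_ HIf]].
    now exists If. }
  assert (Hhg : filterlim h eventually (locally (g : fct_UniformSpace (R * R) C_UniformSpace))).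
  { apply (filterlim_locally (U := fct_UniformSpace (R * R) C_UniformSpace) h g). intros eps.
    assert (He : 0 < eps * k / (4 * M * PI)).
    { apply Rdiv_lt_0_compat; [|nra]. pose proof (cond_pos eps). nra. }
    generalize (zeta_tail_cvg sr _ Hsr He). apply filter_imp. intros N HN [a b].
    apply ball_C_of_Cmod. eapply Rle_lt_trans.
    - apply (sech_Cmod_RInt_le (fun u => G_integrand t sigma u - f N u)%C _ k a b _ Hk (Hdiff N)).
      apply (is_RInt_minus (V := C_R_NormedModule)); [apply Hg|apply Hfh].
    - apply (Rmult_lt_compat_r (4 * M * PI / k)) in HN; [|apply Rdiv_lt_0_compat; nra].
      replace (eps * k / (4 * M * PI) * (4 * M * PI / k)) with (pos eps) in HN by (field; lra).
      replace (2 * (2 * zeta_tail sr N * M / k * PI)) with (zeta_tail sr N * (4 * M * PI / k))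
        by (field; lra).
      easy. }
  (* The partial integrals [h N] converge uniformly in the endpoints, and each has a limit as the
     endpoints go to infinity. Exchanging limits gives one [I] that is both the improper integral
     and the sum of the limits. *)
  destruct (filterlim_switch (U := C_R_CompleteNormedModule) eventually _
    (filter_prod (Rbar_locally m_infty) (Rbar_locally p_infty)) _ h g
    (fun N => sum_n (G := C_AbelianMonoid) (fun n => c n * (0%R, (2 * kmass_lim (l n))%R))%C N) Hhg)
    as [I [HS HI]].
  { intros N. apply (filterlim_sum_n_Cmult _ _ _ c (fun n => kernel_int (l n) q k)).
    intros n. now apply kernel_int_cvg. }
  assert (Hnz : (2 * RtoC PI * Ci)%C <> 0%C).
  { intros H. apply (f_equal Im) in H. unfold Im, Ci, Cmult, RtoC in H; simpl in H. lra. }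
  exists I, (I / (2 * RtoC PI * Ci))%C. split; [|split; [|easy]].
  - intros P HP. specialize (HI P HP). unfold filtermap in HI. unfold filtermapi. revert HI. apply filter_imp.
    intros [a b] Hab. exists (g (a, b)). split; [apply Hg|exact Hab].
  - assert (HS' : is_series (K := C_AbsRing) (V := C_NormedModule)
      (fun n => (2 * RtoC PI * Ci) * G_rhs_term t n)%C I).
    { apply (is_series_ext (fun n => c n * (0%R, (2 * kmass_lim (l n))%R))%C); [|exact HS].
      intros n. now apply kmass_lim_term. }
    apply (is_series_scal (/ (2 * RtoC PI * Ci))%C) in HS'.
    replace (I / (2 * RtoC PI * Ci))%C with (scal (/ (2 * RtoC PI * Ci))%C I : C)
      by (unfold scal; simpl; unfold mult; simpl; unfold Cdiv; ring).
    apply (is_series_ext (fun n => scal (/ (2 * RtoC PI * Ci)) ((2 * RtoC PI * Ci) * G_rhs_term t n))%C); [|exact HS'].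
    intros n. unfold scal; simpl; unfold mult; simpl. rewrite Cmult_assoc, Cinv_l, Cmult_1_l; easy.
Qed.
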